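(* Let $A,B\in\mathbb{C}^{n\times n}$ and let $B=PJP^{-1}$ be the Jordan decomposition of $B$ ($P$ invertible, $J$ in Jordan canonical form). Then there is a matrix $\tilde{A}\in\mathbb{C}^{n\times n}$ with $\det(\tilde{A})=\det(A)$ such that an $n\times n$ matrix $Y$ is a solution of $$z\,\partial_m y=(zA+B)y$$ if and only if $P^{-1}Y$ is a solution of the system $$z\,\partial_m y=(z\tilde{A}+J)y .$$
   Context: Let $m:\{z\in\mathbb{C}:\mathrm{Re}(z)\ge 0\}\to\mathbb{C}$ be a function whose restriction to the nonnegative integers is a sequence of positive real numbers $(m(p))_{p\ge 0}$. Whenever a quotient of values of $m$ is used, its denominator is understood to be nonzero. The moment derivative $\partial_m$ is the linear operator defined on $\mathbb{C}[[z]]$ by $\partial_m\big(\sum_{p\ge 0}\frac{a_p}{m(p)}z^p\big)=\sum_{p\ge 0}\frac{a_{p+1}}{m(p)}z^p$ and, for $\nu\in\mathbb{C}$ with $\mathrm{Re}(\nu)\ge 1$, on $z^{\nu}\mathbb{C}[[z]]=\{\sum_{p\ge 0}a_pz^{\nu+p}:a_p\in\mathbb{C}\}$ by $$\partial_m\Big(\sum_{p\ge 0}a_pz^{p+\nu}\Big)=\sum_{p\ge 0}a_p\frac{m(p+\nu)}{m(p+\nu-1)}z^{p+\nu-1}.$$ It acts entrywise on vectors and matrices. An $n\times n$ matrix $Y$, each of whose columns has all its entries in one of these spaces (possibly a different one for each column), is a solution of a linear system if each of its columns is a solution, i.e. $z\,\partial_mY=(zA+B)Y$. *)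

(* Defs.v *)
From HB Require Import structures.
From mathcomp Require Import all_boot all_order all_algebra.
From mathcomp Require Import all_classical reals.
From mathcomp Require Import complex.
From mathcomp Require Import ring.

Set Implicit Arguments.
Unset Strict Implicit.
Unset Printing Implicit Defensive.

Import Order.TTheory GRing.Theory Num.Theory.
Local Open Scope ring_scope.
Local Open Scope complex_scope.

(* A generalized formal power series is encoded by its coefficient function:
   [f s] is the coefficient of z^s, for s a complex exponent. The [^o] makes
   this a C-module for the pointwise operations. *)
Notation gseries R := (R[i] -> (R[i])^o).

(* \sum_(p >= 0) a_p z^(nu + p). The only candidate p for the exponent s is
   the truncation of Re (s - nu). *)
Definition powser (R : realType) (nu : R[i]) (a : nat -> R[i]) : gseries R :=
  fun s => let p := Num.truncn (complex.Re (s - nu)) in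
           if s == nu + p%:R then a p else 0.

(* z^nu C[[z]]; in particular C[[z]] is the case nu = 0. *)
Definition powser_space (R : realType) (nu : R[i]) (f : gseries R) : Prop :=
  exists a : nat -> R[i], f = powser nu a.

Definition mulz (R : realType) (f : gseries R) : gseries R :=
  fun s => f (s - 1).

(* The moment derivative sends z^(s+1) to (m (s+1) / m s) z^s, and constants
   to 0. On C[[z]] and on z^nu C[[z]] with Re nu >= 1 this is the usual
   definition, see [momentD_powser0] and [momentD_powser]. Only the values of
   m on the half-plane Re >= 0 are used. *)
Definition momentD (R : realType) (m : R[i] -> R[i]) (f : gseries R) :
    gseries R :=
  fun s => if 0 <= complex.Re s then m (s + 1) / m s * f (s + 1) else 0.

(* The exponents nu for which the moment derivative is defined on
   z^nu C[[z]] through quotients of values of m. *)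
Definition moment_exponent (R : realType) (m : R[i] -> R[i]) (nu : R[i]) :
    Prop :=
  1 <= complex.Re nu /\ forall p : nat, m (p%:R + nu - 1) != 0.

Definition admissible (R : realType) (m : R[i] -> R[i]) (n : nat)
    (y : 'cV[gseries R]_n) : Prop :=
  (forall i, powser_space 0 (y i ord0)) \/
  (exists nu, moment_exponent m nu /\ forall i, powser_space nu (y i ord0)).

(* Product of a complex matrix by a matrix of series. *)
Definition cmulmx (R : realType) (n p q : nat) (M : 'M[R[i]]_(n, p))
    (Y : 'M[gseries R]_(p, q)) : 'M[gseries R]_(n, q) :=
  \matrix_(i, j) \sum_k M i k *: Y k j.

(* z d_m y = (z A + B) y *)
Definition system_eq (R : realType) (m : R[i] -> R[i]) (n q : nat)
    (A B : 'M[R[i]]_n) (Y : 'M[gseries R]_(n, q)) : Prop :=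
  map_mx (@mulz R) (map_mx (momentD m) Y) =
  map_mx (@mulz R) (cmulmx A Y) + cmulmx B Y.

Definition is_solution (R : realType) (m : R[i] -> R[i]) (n : nat)
    (A B : 'M[R[i]]_n) (y : 'cV[gseries R]_n) : Prop :=
  admissible m y /\ system_eq m A B y.

Definition is_matrix_solution (R : realType) (m : R[i] -> R[i]) (n : nat)
    (A B : 'M[R[i]]_n) (Y : 'M[gseries R]_n) : Prop :=
  forall j, is_solution m A B (col j Y).

Definition jordan_block (R : realType) (d : nat) (l : R[i]) : 'M[R[i]]_d :=
  \matrix_(i, j) (l *+ (i == j) + (i.+1 == j)%:R).

Definition jordan_form (R : realType) (n : nat) (J : 'M[R[i]]_n) : Prop :=
  exists (k : nat) (d : 'I_k -> nat) (l : 'I_k -> R[i])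
         (e : (\sum_(i < k) d i)%N = n),
    (forall i, (0 < d i)%N) /\
    J = castmx (e, e) (\mxdiag_(i < k) jordan_block (d i) (l i)).

Lemma natrC (R : realType) (p : nat) : (p%:R : R[i]) = (p%:R : R)%:C.
Proof. by rewrite rmorph_nat. Qed.

Lemma powserE (R : realType) (nu : R[i]) (a : nat -> R[i]) (p : nat) :
  powser nu a (nu + p%:R) = a p.
Proof.
rewrite /powser (_ : nu + p%:R - nu = p%:R); last by ring.
by rewrite [X in complex.Re X]natrC /= natrK eqxx.
Qed.

Lemma powser_out (R : realType) (nu : R[i]) (a : nat -> R[i]) (s : R[i]) :
  (forall p : nat, s != nu + p%:R) -> powser nu a s = 0.
Proof. by move=> h; rewrite /powser (negbTE (h _)). Qed.

Lemma powserP (R : realType) (nu : R[i]) (a : nat -> R[i]) (f : gseries R) :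
  (forall p : nat, f (nu + p%:R) = a p) ->
  (forall s, (forall p : nat, s != nu + p%:R) -> f s = 0) ->
  f = powser nu a.
Proof.
move=> fin fout; apply/funext => s.
have [[p ->]|h] := pselect (exists p : nat, s = nu + p%:R).
  by rewrite fin powserE.
have h' p : s != nu + p%:R by apply/eqP => e; apply: h; exists p.
by rewrite fout// powser_out.
Qed.

Lemma momentD_powser0 (R : realType) (m : R[i] -> R[i]) (a : nat -> R[i]) :
  (forall p : nat, 0 < m p%:R) ->
  momentD m (powser 0 (fun p => a p / m p%:R)) =
  powser 0 (fun p => a p.+1 / m p%:R).
Proof.
move=> m0; apply: powserP => [p|s h].
  rewrite add0r /momentD [X in complex.Re X]natrC /= ler0n natr1.
  rewrite -[in powser _ _ _](add0r p.+1%:R) powserE.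
  by field; rewrite !gt_eqF.
rewrite /momentD; case: ifPn => // s0.
rewrite powser_out ?mulr0// => -[|p].
  apply/eqP => e; move: s0; have -> : s = -1 by rewrite -[s](addrK 1) e !add0r.
  by rewrite /= oppr_ge0 ler10.
by rewrite -natr1 addrA (inj_eq (addIr _)).
Qed.

Lemma momentD_powser (R : realType) (m : R[i] -> R[i]) (nu : R[i])
    (a : nat -> R[i]) :
  1 <= complex.Re nu ->
  momentD m (powser nu a) =
  powser (nu - 1) (fun p => a p * (m (p%:R + nu) / m (p%:R + nu - 1))).
Proof.
move=> nu1; apply: powserP => [p|s h].
  rewrite /momentD ifT; last first.
    case: nu nu1 => x y /= x1.
    by rewrite natrC /= addr_ge0 ?subr_ge0 ?ler0n.
  have -> : nu - 1 + p%:R + 1 = nu + p%:R by ring.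
  by rewrite powserE mulrC (addrC nu) (_ : nu - 1 + _ = p%:R + nu - 1)//; ring.
rewrite /momentD powser_out ?mulr0 ?if_same// => p.
by apply: contra (h p) => /eqP e; rewrite -[s](addrK 1) e; apply/eqP; ring.
Qed.

Lemma system_eq_col (R : realType) (m : R[i] -> R[i]) (n : nat)
    (A B : 'M[R[i]]_n) (Y : 'M[gseries R]_n) :
  system_eq m A B Y <-> forall j, system_eq m A B (col j Y).
Proof.
have cE M (j : 'I_n) : cmulmx M (col j Y) = col j (cmulmx M Y).
  by apply/matrixP => i k; rewrite !mxE; apply: eq_bigr => l _; rewrite !mxE.
have colD (M N : 'M[gseries R]_n) j : col j (M + N) = col j M + col j N.
  by apply/matrixP => i k; rewrite !mxE.
rewrite /system_eq; split=> [h j|h].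
  by rewrite !cE !map_col h colD.
apply/matrixP => i j; have /matrixP/(_ i ord0) := h j.
by rewrite !cE !map_col -colD [col _ _ i _]mxE [col _ (_ + _) i _]mxE.
Qed.

(* Main.v *)
Require Import Defs.
From HB Require Import structures.
From mathcomp Require Import all_boot all_order all_algebra.
From mathcomp Require Import all_classical reals.
From mathcomp Require Import complex.
Import Order.TTheory GRing.Theory Num.Theory.
Local Open Scope ring_scope.
Local Open Scope complex_scope.

(** A constant change of unknown [y = P x] conjugates both coefficients of the
    system, so [At = P^-1 A P] works, and [P^-1 B P = J].  For this the moment
    derivative and the multiplication by [z] only have to be linear, because
    they then commute with the left product by a constant matrix
    ([cmulmx_map_linear]), and the spaces [z^nu C[[z]]] have to be stable under
    linear combinations with a common exponent [nu], so that such a product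
    preserves the admissibility of a column ([admissible_cmulmx]).  Hence a
    product by any invertible constant matrix sends solutions to solutions of
    the conjugate system ([is_solution_conj]); the two directions of the
    equivalence are this fact for [P^-1] and for [P]. *)

Lemma mulz_is_linear (R : realType) : linear (@mulz R).
Proof. by []. Qed.

HB.instance Definition _ (R : realType) :=
  GRing.isLinear.Build R[i] (gseries R) (gseries R) _ (@mulz R)
    (mulz_is_linear R).

Lemma momentD_is_linear (R : realType) (m : R[i] -> R[i]) :
  linear (momentD m).
Proof.
move=> a f g; apply/funext => s.
rewrite addrfctE scalrfctE /momentD addrfctE scalrfctE.
case: ifPn => _; last by rewrite scaler0 addr0.
by rewrite mulrDr -[a *: f _]/(a * f _) mulrCA.
Qed.

HB.instance Definition _ (R : realType) (m : R[i] -> R[i]) :=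
  GRing.isLinear.Build R[i] (gseries R) (gseries R) _ (momentD m)
    (momentD_is_linear R m).

Section ConstantMatrixProduct.
Variable R : realType.

Lemma cmulmxA n p q r (M : 'M[R[i]]_(n, p)) (N : 'M[R[i]]_(p, q))
    (Y : 'M[gseries R]_(q, r)) :
  cmulmx M (cmulmx N Y) = cmulmx (M *m N) Y.
Proof.
apply/matrixP => i j; rewrite !mxE.
under eq_bigr => k _ do rewrite mxE scaler_sumr.
rewrite exchange_big /=; apply: eq_bigr => l _.
by rewrite mxE scaler_suml; apply: eq_bigr => k _; rewrite scalerA.
Qed.

Lemma cmul1mx n q (Y : 'M[gseries R]_(n, q)) : cmulmx 1%:M Y = Y.
Proof.
apply/matrixP => i j; rewrite mxE (bigD1 i)//= mxE eqxx scale1r.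
rewrite big1 ?addr0// => k ki.
by rewrite mxE eq_sym (negbTE ki) scale0r.
Qed.

Lemma cmulmxDr n p q (M : 'M[R[i]]_(n, p)) (Y Z : 'M[gseries R]_(p, q)) :
  cmulmx M (Y + Z) = cmulmx M Y + cmulmx M Z.
Proof.
apply/matrixP => i j; rewrite !mxE -big_split; apply: eq_bigr => k _.
by rewrite mxE scalerDr.
Qed.

Lemma cmulmx_map_linear (f : {linear gseries R -> gseries R}) n p q
    (M : 'M[R[i]]_(n, p)) (Y : 'M[gseries R]_(p, q)) :
  map_mx f (cmulmx M Y) = cmulmx M (map_mx f Y).
Proof.
apply/matrixP => i j; rewrite !mxE linear_sum; apply: eq_bigr => k _.
by rewrite linearZ mxE.
Qed.

Lemma col_cmulmx n p q (M : 'M[R[i]]_(n, p)) (Y : 'M[gseries R]_(p, q)) j :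
  col j (cmulmx M Y) = cmulmx M (col j Y).
Proof.
by apply/matrixP => i k; rewrite !mxE; apply: eq_bigr => l _; rewrite mxE.
Qed.

End ConstantMatrixProduct.

Lemma powser_space_lincomb (R : realType) (nu : R[i]) (I : finType)
    (c : I -> R[i]) (f : I -> gseries R) :
  (forall k, powser_space nu (f k)) ->
  powser_space nu (\sum_k c k *: f k).
Proof.
move=> /choice[a fE]; exists (fun p => \sum_k c k * a k p).
apply: powserP => [p|s h]; rewrite fct_sumE.
  by apply: eq_bigr => k _; rewrite scalrfctE fE powserE.
by apply: big1 => k _; rewrite scalrfctE fE powser_out// scaler0.
Qed.

Lemma admissible_cmulmx (R : realType) (m : R[i] -> R[i]) (n : nat)
    (Q : 'M[R[i]]_n) (y : 'cV[gseries R]_n) :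
  admissible m y -> admissible m (cmulmx Q y).
Proof.
case=> [y0|[nu [nu_m ynu]]]; [left=> i|right; exists nu; split=> // i];
  by rewrite mxE; apply: powser_space_lincomb.
Qed.

(** Multiplying the equation on the left by [Q] and inserting [invmx Q *m Q]
    in front of the unknown gives the conjugate system. *)
Lemma is_solution_conj (R : realType) (m : R[i] -> R[i]) (n : nat)
    (Q A B : 'M[R[i]]_n) (y : 'cV[gseries R]_n) :
  Q \in unitmx -> is_solution m A B y ->
  is_solution m (Q *m A *m invmx Q) (Q *m B *m invmx Q) (cmulmx Q y).
Proof.
move=> Qu [adm eqy]; split; first exact: admissible_cmulmx.
rewrite /system_eq !cmulmxA !mulmxKV// !cmulmx_map_linear eqy cmulmxDr.
by rewrite -!cmulmxA !cmulmx_map_linear.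
Qed.

Theorem proposition4p1 (R : realType) (m : R[i] -> R[i])
    (m_gt0 : forall p : nat, 0 < m p%:R)
    (n : nat) (A B P J : 'M[R[i]]_n)
    (P_unit : P \in unitmx) (J_jordan : jordan_form J)
    (B_def : B = P *m J *m invmx P) :
  exists At : 'M[R[i]]_n,
    \det At = \det A /\
    forall Y : 'M[gseries R]_n,
      is_matrix_solution m A B Y <->
      is_matrix_solution m At J (cmulmx (invmx P) Y).
Proof.
exists (invmx P *m A *m P); split.
  by rewrite !det_mulmx mulrAC -det_mulmx mulVmx// det1 mul1r.
move=> Y; split=> sol j.
  rewrite col_cmulmx.
  have -> : J = invmx P *m B *m P.
    by rewrite B_def !mulmxA mulVmx// mul1mx mulmxKV.
  have := is_solution_conj R m n (invmx P) A B (col j Y).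
  by rewrite invmxK unitmx_inv; apply.
have -> : A = P *m (invmx P *m A *m P) *m invmx P.
  by rewrite !mulmxA mulmxV// mul1mx mulmxK.
have -> : Y = cmulmx P (cmulmx (invmx P) Y).
  by rewrite cmulmxA mulmxV// cmul1mx.
by rewrite B_def [col _ _]col_cmulmx; apply: is_solution_conj.
Qed.
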